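(* Let $n\ge 1$ and let $\mathbf{\Pi}_{\mathrm{COP}},\mathbf{\Pi}_{\mathrm{NN}},\mathbf{\Pi}_{\mathrm{OZF}},\mathbf{\Pi}_{\mathrm{Faz}}\subset\mathbb{S}^{2n+1}$ be the sets of multipliers defined in the context. Then $$\mathbf{\Pi}_{\mathrm{OZF}}\subset\mathbf{\Pi}_{\mathrm{NN}}\subset\mathbf{\Pi}_{\mathrm{COP}}\qquad\text{and}\qquad \mathbf{\Pi}_{\mathrm{Faz}}\subset\mathbf{\Pi}_{\mathrm{NN}}\subset\mathbf{\Pi}_{\mathrm{COP}}.$$
   Context: $\mathbb{S}^k$ is the set of real symmetric $k\times k$ matrices, $\mathbb{D}^n$ the set of real diagonal $n\times n$ matrices. The copositive cone is $\mathcal{COP}^k=\{P\in\mathbb{S}^k: x^TPx\ge 0\ \text{for all entrywise nonnegative } x\in\mathbb{R}^k\}$ and the nonnegative cone is $\mathcal{NN}^k=\{P\in\mathbb{S}^k: P_{ij}\ge 0\ \text{for all } i,j\}$. In block symmetric matrices, $\ast$ denotes the block determined by symmetry. Inclusions $\subset$ are not necessarily strict. Copositive multipliers and their inner approximation: let $$E=\begin{bmatrix}1&0_{1,n}&0_{1,n}\\ 0_{n,1}&-I_n&I_n\\ 0_{n,1}&0_{n,n}&I_n\end{bmatrix},\qquad \mathcal{J}(J)=\begin{bmatrix}0&0_{1,n}&0_{1,n}\\ \ast&0_{n,n}&J\\ \ast&\ast&0_{n,n}\end{bmatrix}.$$ Then $$\mathbf{\Pi}_{\mathrm{COP}}=\{E^T(Q+\mathcal{J}(J))E:\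 J\in\mathbb{D}^n,\ Q\in\mathcal{COP}^{2n+1}\},$$ $$\mathbf{\Pi}_{\mathrm{NN}}=\{E^T(Q+\mathcal{J}(J))E:\ J\in\mathbb{D}^n,\ Q\in\mathcal{NN}^{2n+1}\}.$$ O'Shea-Zames-Falb multipliers: a matrix $M\in\mathbb{R}^{n\times n}$ is doubly hyperdominant, written $M\in\mathcal{DHD}^n$, if $M_{ij}\le 0$ for all $i\ne j$ and $M\mathbf{1}_n\ge 0$, $\mathbf{1}_n^TM\ge 0$ entrywise, where $\mathbf{1}_n$ is the all-ones vector. Define $$\mathbf{\Pi}_{\mathrm{OZF}}=\left\{\begin{bmatrix}0&0_{1,2n}\\ 0_{2n,1}&\hat\Pi\end{bmatrix}:\ \hat\Pi=\begin{bmatrix}I_n&-I_n\\ 0&I_n\end{bmatrix}^T\begin{bmatrix}0&M\\ M^T&0\end{bmatrix}\begin{bmatrix}I_n&-I_n\\ 0&I_n\end{bmatrix},\ M\in\mathcal{DHD}^n\right\}.$$ Multipliers of Fazlyab et al.: with $e_i$ the $i$-th standard unit vector of $\mathbb{R}^n$, let $$\mathbb{T}^n=\Big\{T\in\mathbb{S}^n:\ T=\sum_{1\le i<j\le n}\lambda_{ij}(e_i-e_j)(e_i-e_j)^T,\ \lambda_{ij}\ge 0\Big\}.$$ Define $$\mathbf{\Pi}_{\mathrm{Faz}}=\left\{\begin{bmatrix}0&-\nu&\nu+\eta\\ \ast&0&\Lambda+T\\ \ast&\ast&-2(\Lambda+T)\end{bmatrix}:\ \nu^T,\eta^T\in\mathbb{R}^n_+,\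 \Lambda\in\mathbb{D}^n,\ T\in\mathbb{T}^n\right\},$$ where $\mathbb{R}^n_+$ is the set of entrywise nonnegative vectors (so $\nu,\eta$ are nonnegative row vectors). *)

(* Defs.v *)
From mathcomp Require Import all_boot all_order all_algebra.
From mathcomp Require Import classical_sets reals.

Set Implicit Arguments.
Unset Strict Implicit.
Unset Printing Implicit Defensive.

Import Order.TTheory GRing.Theory Num.Theory.
Local Open Scope ring_scope.
Local Open Scope classical_set_scope.

(* Matrices of size 2n+1 are represented in 'M_(1 + (n + n)), which carries the
   block decomposition (1, n, n). Entrywise nonnegativity of a matrix or vector
   A is A \is a mxOver Num.nneg. *)

Definition symmetric_mxs (R : realType) (k : nat) : set 'M[R]_k :=
  [set P : 'M[R]_k | P^T = P].

Definition diagonal_mxs (R : realType) (n : nat) : set 'M[R]_n :=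
  [set D | is_diag_mx D].

Definition copositive_cone (R : realType) (k : nat) : set 'M[R]_k :=
  [set P | symmetric_mxs P /\
    forall x : 'cV[R]_k, x \is a mxOver Num.nneg -> 0 <= (x^T *m P *m x) 0 0].

Definition nonneg_cone (R : realType) (k : nat) : set 'M[R]_k :=
  [set P | symmetric_mxs P /\ P \is a mxOver Num.nneg].

Definition block3_mx (R : realType) (n : nat)
    (A11 : 'M[R]_1) (A12 A13 : 'rV[R]_n)
    (A21 : 'cV[R]_n) (A22 A23 : 'M[R]_n)
    (A31 : 'cV[R]_n) (A32 A33 : 'M[R]_n) : 'M[R]_(1 + (n + n)) :=
  block_mx A11 (row_mx A12 A13)
           (col_mx A21 A31) (block_mx A22 A23 A32 A33).

(* The blocks below the diagonal are filled in by symmetry; A11, A22 and A33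
   are taken as they are. *)
Definition symblock3_mx (R : realType) (n : nat)
    (A11 : 'M[R]_1) (A12 A13 : 'rV[R]_n) (A22 A23 A33 : 'M[R]_n) :
    'M[R]_(1 + (n + n)) :=
  block3_mx A11   A12   A13
            A12^T A22   A23
            A13^T A23^T A33.

Definition E_mx (R : realType) (n : nat) : 'M[R]_(1 + (n + n)) :=
  block3_mx 1%:M 0         0
            0    (- 1%:M)  1%:M
            0    0         1%:M.

Definition calJ_mx (R : realType) (n : nat) (J : 'M[R]_n) :
    'M[R]_(1 + (n + n)) :=
  symblock3_mx 0 0 0
                 0 J
                   0.

Definition Pi_COP (R : realType) (n : nat) : set 'M[R]_(1 + (n + n)) :=
  [set P | exists J Q, [/\ @diagonal_mxs R n J,
     @copositive_cone R (1 + (n + n)) Q &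
     P = (E_mx R n)^T *m (Q + calJ_mx J) *m E_mx R n]].

Definition Pi_NN (R : realType) (n : nat) : set 'M[R]_(1 + (n + n)) :=
  [set P | exists J Q, [/\ @diagonal_mxs R n J,
     @nonneg_cone R (1 + (n + n)) Q &
     P = (E_mx R n)^T *m (Q + calJ_mx J) *m E_mx R n]].

Definition doubly_hyperdominant (R : realType) (n : nat) : set 'M[R]_n :=
  [set M : 'M[R]_n | [/\ forall i j : 'I_n, i != j -> M i j <= 0,
     M *m (const_mx 1 : 'cV[R]_n) \is a mxOver Num.nneg &
     (const_mx 1 : 'rV[R]_n) *m M \is a mxOver Num.nneg]].

Definition OZF_block (R : realType) (n : nat) (M : 'M[R]_n) : 'M[R]_(n + n) :=
  let W : 'M[R]_(n + n) := block_mx 1%:M (- 1%:M) 0 1%:M in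
  W^T *m block_mx 0 M M^T 0 *m W.

Definition Pi_OZF (R : realType) (n : nat) : set 'M[R]_(1 + (n + n)) :=
  [set P | exists M, @doubly_hyperdominant R n M /\
     P = block_mx (0 : 'M[R]_1) 0 0 (OZF_block M)].

Definition unit_cV (R : realType) (n : nat) (i : 'I_n) : 'cV[R]_n :=
  delta_mx i 0.

(* Only the values lambda i j with i < j are relevant. *)
Definition Faz_T (R : realType) (n : nat) : set 'M[R]_n :=
  [set T | symmetric_mxs T /\
    exists lambda : 'I_n -> 'I_n -> R,
      (forall i j : 'I_n, (i < j)%N -> 0 <= lambda i j) /\
      T = \sum_(i < n) \sum_(j < n | (i < j)%N)
            lambda i j *: ((unit_cV R i - unit_cV R j) *m
                           (unit_cV R i - unit_cV R j)^T)].

Definition Pi_Faz (R : realType) (n : nat) : set 'M[R]_(1 + (n + n)) :=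
  [set P | exists (nu eta : 'rV[R]_n) (Lambda T : 'M[R]_n),
     [/\ nu^T \is a mxOver Num.nneg, eta^T \is a mxOver Num.nneg,
         diagonal_mxs Lambda, Faz_T T &
         P = symblock3_mx 0 (- nu) (nu + eta)
                            0      (Lambda + T)
                                   (- 2%:R *: (Lambda + T))]].

Lemma congr_sym (R : realType) (k m : nat) (A : 'M[R]_(k, m)) (S : 'M[R]_k) :
  symmetric_mxs S -> symmetric_mxs (A^T *m S *m A).
Proof.
by rewrite /symmetric_mxs /= => HS; rewrite !trmx_mul trmxK HS mulmxA.
Qed.

Lemma calJ_sym (R : realType) (n : nat) (J : 'M[R]_n) :
  symmetric_mxs (calJ_mx J).
Proof.
rewrite /symmetric_mxs /= /calJ_mx /symblock3_mx /block3_mx.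
by rewrite !tr_block_mx tr_row_mx tr_col_mx !trmxK !trmx0.
Qed.

Lemma Pi_COP_sym (R : realType) (n : nat) :
  @Pi_COP R n `<=` @symmetric_mxs R (1 + (n + n)).
Proof.
move=> P [J [Q [_ [HQ _] ->]]]; apply: congr_sym.
have HJ := calJ_sym J.
by move: HQ HJ; rewrite /symmetric_mxs /= => HQ HJ; rewrite linearD /= HQ HJ.
Qed.

Lemma Pi_NN_sym (R : realType) (n : nat) :
  @Pi_NN R n `<=` @symmetric_mxs R (1 + (n + n)).
Proof.
move=> P [J [Q [_ [HQ _] ->]]]; apply: congr_sym.
have HJ := calJ_sym J.
by move: HQ HJ; rewrite /symmetric_mxs /= => HQ HJ; rewrite linearD /= HQ HJ.
Qed.

Lemma Pi_OZF_sym (R : realType) (n : nat) :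
  @Pi_OZF R n `<=` @symmetric_mxs R (1 + (n + n)).
Proof.
move=> P [M [_ ->]].
have HM : symmetric_mxs (OZF_block M).
  by apply: congr_sym; rewrite /symmetric_mxs /= tr_block_mx trmxK !trmx0.
by move: HM; rewrite /symmetric_mxs /= => HM; rewrite tr_block_mx HM !trmx0.
Qed.

Lemma Pi_Faz_sym (R : realType) (n : nat) :
  @Pi_Faz R n `<=` @symmetric_mxs R (1 + (n + n)).
Proof.
move=> P [nu [eta [L [T [_ _ HL [HT _] ->]]]]].
have HLs : L^T = L.
  have /is_diag_mxP HL' : is_diag_mx L by [].
  apply/matrixP => i j; rewrite mxE.
  have [->//|ne] := eqVneq i j.
  by rewrite !HL' // eq_sym.
move: HT; rewrite /symmetric_mxs /= /symblock3_mx /block3_mx => HT.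
rewrite !tr_block_mx tr_row_mx tr_col_mx !trmxK !trmx0.
have HS : (L + T)^T = L + T by rewrite linearD /= HLs HT.
by rewrite linearZ /= !HS ?trmx0.
Qed.

(* Main.v *)
Require Import Defs.
From mathcomp Require Import all_boot all_order all_algebra.
From mathcomp Require Import classical_sets reals.

(* E is an involution, so a multiplier P lies in Pi_NN as soon as E^T P E is the
   sum of a nonnegative matrix and some calJ_mx J.  For both the OZF and the
   Fazlyab multipliers, E^T P E has zero diagonal blocks, a nonnegative first row
   and a (2,3) block -N, where N is M, respectively Lambda + T.  The off-diagonal
   entries of N are nonpositive, and its diagonal is absorbed by J. *)

Import Order.TTheory GRing.Theory Num.Theory.

Local Open Scope ring_scope.
Local Open Scope classical_set_scope.

Lemma mxOver_tr (T : Type) (S : {pred T}) (m n : nat) (A : 'M[T]_(m, n)) :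
  (A^T%R \is a mxOver S) = (A \is a mxOver S).
Proof.
by apply/mxOverP/mxOverP => AS i j; have := AS j i; rewrite mxE.
Qed.

Lemma mxOver_block (T : Type) (S : {pred T}) (m1 m2 n1 n2 : nat)
    (A : 'M[T]_(m1, n1)) (B : 'M[T]_(m1, n2))
    (C : 'M[T]_(m2, n1)) (D : 'M[T]_(m2, n2)) :
    A \is a mxOver S -> B \is a mxOver S ->
    C \is a mxOver S -> D \is a mxOver S ->
  block_mx A B C D \is a mxOver S.
Proof.
move=> /mxOverP AS /mxOverP BS /mxOverP CS /mxOverP DS; apply/mxOverP => i j.
by rewrite !mxE; case: split => k; rewrite mxE; case: split.
Qed.

Lemma mxOver_row_mx (T : Type) (S : {pred T}) (m n1 n2 : nat)
    (A : 'M[T]_(m, n1)) (B : 'M[T]_(m, n2)) :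
  A \is a mxOver S -> B \is a mxOver S -> row_mx A B \is a mxOver S.
Proof.
move=> /mxOverP AS /mxOverP BS; apply/mxOverP => i j.
by rewrite mxE; case: split.
Qed.

(** For [x] nonnegative, the form [x^T *m Q *m x] is a product of entrywise nonnegative matrices;
    [J] and [Q] can therefore be kept. *)
Lemma Pi_NN_sub_COP (R : realType) (n : nat) : @Pi_NN R n `<=` @Pi_COP R n.
Proof.
move=> P [J [Q [dJ [sQ Q0] ->]]]; exists J, Q; split=> //; split=> // x x0.
have /mxOverP/(_ 0 0) : x^T *m Q *m x \is a mxOver Num.nneg.
  by rewrite !mxOverM // mxOver_tr.
by rewrite nnegrE.
Qed.

Lemma E_congr_symblock3 (R : realType) (n : nat) (a b : 'rV[R]_n)
    (N : 'M[R]_n) :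
  (E_mx R n)^T *m symblock3_mx 0 a b 0 (- N) 0 *m E_mx R n =
  symblock3_mx 0 (- a) (a + b) 0 N (- (N + N^T)).
Proof.
rewrite /E_mx /symblock3_mx /block3_mx !row_mx0 !col_mx0.
rewrite !(tr_block_mx, tr_row_mx, tr_col_mx) !trmx0 !linearN linearD /= !trmx1.
rewrite !(mulmx_block, mul_row_block, mul_block_col).
rewrite !(mul0mx, mulmx0, mul1mx, mulmx1, mulNmx, mulmxN, addr0, add0r, oppr0).
rewrite !(mulmx_block, mul_row_block, mul_block_col).
rewrite !(mul0mx, mulmx0, mul1mx, mulmx1, mulNmx, mulmxN, addr0, add0r, oppr0).
by rewrite !opprK opprD [- N - _]addrC.
Qed.

(** Membership test shared by both families: OZF multipliers are the case [a = b = 0], [N = M], and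
    Fazlyab multipliers the case [a = nu], [b = eta], [N = Lambda + T]. *)
Lemma Pi_NN_symblock3 (R : realType) (n : nat) (a b : 'rV[R]_n) (N : 'M[R]_n) :
    a \is a mxOver Num.nneg -> b \is a mxOver Num.nneg ->
    (forall i j, i != j -> N i j <= 0) ->
  Pi_NN (symblock3_mx 0 (- a) (a + b) 0 N (- (N + N^T))).
Proof.
move=> a0 b0 N0; pose D := diag_mx (\row_i N i i).
(* With [D] the diagonal part of [N], the block [D - N] has zero diagonal and entries [- N i j >= 0]
   elsewhere; adding [J = - D] restores [- N]. *)
exists (- D), (symblock3_mx 0 a b 0 (D - N) 0); split.
- apply/is_diag_mxP => i j ij; rewrite mxE.
  by rewrite (is_diag_mxP (diag_mx_is_diag _)) ?oppr0.
- split.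
    rewrite /symmetric_mxs /= /symblock3_mx /block3_mx.
    by rewrite !tr_block_mx tr_row_mx tr_col_mx !trmxK !trmx0.
  have DN0 : D - N \is a mxOver Num.nneg.
    apply/mxOverP => i j; rewrite nnegrE !mxE.
    by have [->|/N0 Nij] := eqVneq i j; rewrite ?subrr // sub0r oppr_ge0.
  have Z0 k m : (0 : 'M[R]_(k, m)) \is a mxOver Num.nneg by rewrite mxOver0 ?nnegrE.
  apply: mxOver_block; rewrite ?Z0 ?mxOver_row_mx //.
    by rewrite -tr_row_mx mxOver_tr mxOver_row_mx.
  by rewrite mxOver_block ?mxOver_tr.
- rewrite -E_congr_symblock3; congr (_ *m _ *m _).
  rewrite /calJ_mx /symblock3_mx /block3_mx !add_block_mx !add_row_mx !add_col_mx.
  rewrite !trmx0 !addr0 -linearD /=.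
  by rewrite addrAC subrr sub0r.
Qed.

Lemma OZF_symblock3 (R : realType) (n : nat) (M : 'M[R]_n) :
  block_mx (0 : 'M[R]_1) 0 0 (OZF_block M) =
  symblock3_mx 0 0 0 0 M (- (M + M^T)).
Proof.
rewrite /OZF_block /symblock3_mx /block3_mx tr_block_mx !mulmx_block.
rewrite !linearN /= !trmx1 !trmx0 row_mx0 col_mx0.
rewrite !(mul0mx, mulmx0, mul1mx, mulmx1, mulNmx, mulmxN, addr0, add0r, oppr0).
by rewrite opprD addrC.
Qed.

(** For [k != l], the [(k, l)] entry of the rank-one matrix built from [i < j] is [-1] if
    [{k, l} = {i, j}] and [0] otherwise, so [T] is a nonnegative combination of nonpositive entries
    there. *)
Lemma Faz_T_offdiag_le0 (R : realType) (n : nat) (T : 'M[R]_n) (k l : 'I_n) :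
  Faz_T T -> k != l -> T k l <= 0.
Proof.
move=> [_ [lam [lam0 ->]]] kl.
rewrite summxE sumr_le0 // => i _; rewrite summxE sumr_le0 // => j ij.
rewrite !mxE big_ord1 !mxE mulr_ge0_le0 ?lam0 //.
have nij : i != j by rewrite neq_ltn ij.
rewrite !andbT.
have [ki|ki] := eqVneq k i; have [kj|kj] := eqVneq k j;
  have [li|li] := eqVneq l i; have [lj|lj] := eqVneq l j;
  rewrite ?(subrr, subr0, sub0r, mulr0, mul0r, mulr1, mul1r, oppr_le0) //.
(* What remains are coincidences of indices excluded by [k != l] or [i != j]. *)
all: by subst; rewrite ?eqxx in nij kl.
Qed.

Lemma Pi_OZF_sub_NN (R : realType) (n : nat) : @Pi_OZF R n `<=` @Pi_NN R n.
Proof.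
move=> P [M [[M0 _ _] ->]]; rewrite OZF_symblock3.
have Z0 : (0 : 'rV[R]_n) \is a mxOver Num.nneg by rewrite mxOver0 ?nnegrE.
by have := Pi_NN_symblock3 _ _ _ _ _ Z0 Z0 M0; rewrite oppr0 addr0.
Qed.

Lemma Pi_Faz_sub_NN (R : realType) (n : nat) : @Pi_Faz R n `<=` @Pi_NN R n.
Proof.
move=> P [nu [eta [L [T [nu0 eta0 /is_diag_mxP dL FT ->]]]]].
have sL : L^T = L.
  apply/matrixP => i j; rewrite mxE.
  by have [->//|ij] := eqVneq i j; rewrite !dL // eq_sym.
have sLT : (L + T)^T = L + T by case: FT => sT _; rewrite linearD /= sL sT.
(* Symmetry of [L + T] brings the last block into the form [- (N + N^T)]. *)
have -> : - 2%:R *: (L + T) = - ((L + T) + (L + T)^T).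
  by rewrite sLT scaleNr scaler_nat mulr2n.
rewrite !mxOver_tr in nu0 eta0; apply: Pi_NN_symblock3 => // i j ij.
by rewrite mxE dL // add0r Faz_T_offdiag_le0.
Qed.

Theorem theorem3 (R : realType) (n : nat) (hn : (1 <= n)%N) :
  (@Pi_OZF R n `<=` @Pi_NN R n /\ @Pi_NN R n `<=` @Pi_COP R n) /\
  (@Pi_Faz R n `<=` @Pi_NN R n /\ @Pi_NN R n `<=` @Pi_COP R n).
Proof.
by do 2!split; [exact: Pi_OZF_sub_NN|exact: Pi_NN_sub_COP
  |exact: Pi_Faz_sub_NN|exact: Pi_NN_sub_COP].
Qed.
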